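(* Let $\mathcal{D}$ be a probability distribution on $\mathbb{R}^d$ that is a mixture of $k$ distributions $\mathcal{D}^1,\dots,\mathcal{D}^k$. Suppose there are constants $0<D<\infty$ and $0<\rho<\infty$ such that (1) for each $1\le i\le k$, $\mathbb{E}_{x\sim\mathcal{D}^i}\big[d(x,\mathbb{E}_{x'\sim\mathcal{D}}[x'])^2\big]\le D$, and (2) $\mathcal{D}$ has a probability density (with respect to Lebesgue measure) bounded by $\rho$. Then for $X\sim\mathcal{D}^n$ (i.e., $n$ i.i.d. samples), with probability at least $1-\frac{2}{n}$, $\mathrm{OC}_k(X)=O(k^2\log n)$.
   Context: $d$ is Euclidean distance. $\mathrm{diam}(P)=\max_{x,y\in P}d(x,y)$; $\mathrm{diam}_\ell(P)$ is the minimum over partitions of $P$ into at most $\ell$ parts of the largest part diameter ($\mathrm{diam}_0(P)=+\infty$ for nonempty $P$). A $(2,k)$-sequence is a sequence $y_1,\dots,y_m$ with $\min_{i<j}d(y_i,y_j)>2\,\mathrm{diam}_{k-1}(\{y_1,\dots,y_{j-1}\})$ for all $1<j\le m$. $\mathrm{OC}_k(X)$ is the maximum length of a $(2,k)$-sequence of distinct points of $X$. The implied constant in $O(\cdot)$ depends only on the distribution (through $d$, $D$, $\rho$), and the bound is meant for all sufficiently large $n$. *)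

(* Defs.v *)
From HB Require Import structures.
From mathcomp Require Import all_boot all_order all_algebra.
From mathcomp Require Import all_classical all_reals all_analysis.

Set Implicit Arguments.
Unset Strict Implicit.
Unset Printing Implicit Defensive.

Import Order.TTheory GRing.Theory Num.Theory.
Import numFieldNormedType.Exports.

Local Open Scope classical_set_scope.
Local Open Scope ring_scope.

Section cons_product.
Local Open Scope ereal_scope.
Context d (T : measurableType d) (R : realType) (n : nat).

Definition tcons (p : T * n.-tuple T) : n.+1.-tuple T := [tuple of p.1 :: p.2].

Lemma measurable_tcons : measurable_fun [set: T * n.-tuple T] tcons.
Proof. exact: measurable_cons. Qed.

Definition cyl (B : set T) (C : set (n.-tuple T)) : set (n.+1.-tuple T) :=
  [set t | B (thead t) /\ C [tuple of behead t]].

Lemma measurable_cyl B C : measurable B -> measurable C -> measurable (cyl B C).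
Proof.
move=> mB mC; rewrite (_ : cyl B C = (@thead n T @^-1` B) `&`
  ((fun t : n.+1.-tuple T => [tuple of behead t]) @^-1` C)) //.
apply: measurableI; rewrite -[X in measurable X]setTI.
  exact: measurable_tnth.
exact: measurable_behead.
Qed.

Lemma tcons_preimage B C : tcons @^-1` cyl B C = B `*` C.
Proof.
suff H x (t : n.-tuple T) : cyl B C (tcons (x, t)) = (B x /\ C t).
  by apply/seteqP; split=> -[x t]; rewrite /= H.
by rewrite /cyl/= theadE; congr (_ /\ C _); exact: val_inj.
Qed.

Definition cons_product (mu : set T -> \bar R) (nu : set (n.-tuple T) -> \bar R)
  : set (n.+1.-tuple T) -> \bar R := pushforward (mu \x nu) tcons.

Variables (mu : {sigma_finite_measure set T -> \bar R})
  (nu : {sigma_finite_measure set (n.-tuple T) -> \bar R}).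

Lemma cons_product_cyl B C : measurable B -> measurable C ->
  cons_product mu nu (cyl B C) = mu B * nu C.
Proof.
by move=> mB mC; rewrite /cons_product /pushforward tcons_preimage product_measure1E.
Qed.

Let cons_product0 : cons_product mu nu set0 = 0.
Proof. by rewrite /cons_product /pushforward preimage_set0 measure0. Qed.


Let cons_product_ge0 A : 0 <= cons_product mu nu A.
Proof. by apply: integral_ge0 => x _; exact: measure_ge0. Qed.

Let cons_product_sigma_additive : semi_sigma_additive (cons_product mu nu).
Proof.
have m := measurable_tcons.
exact: measure_semi_sigma_additive.
Qed.

HB.instance Definition _ := isMeasure.Build _ _ _ (cons_product mu nu)
  cons_product0 cons_product_ge0 cons_product_sigma_additive.

Let cons_product_sigma_finite : sigma_finite setT (cons_product mu nu).
Proof.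
have /sigma_finiteP[F [TF ndF Foo]] := sigma_finiteT mu.
have /sigma_finiteP[G [TG ndG Goo]] := sigma_finiteT nu.
exists (fun i => cyl (F i) (G i)).
  apply/esym/seteqP; split=> // t _.
  have : [set: T] (thead t) by [].
  rewrite TF => -[i _ Fi].
  have : [set: n.-tuple T] [tuple of behead t] by [].
  rewrite TG => -[j _ Gj].
  exists (maxn i j) => //; split.
  - by move: Fi; exact/subsetPset/ndF/leq_maxl.
  - by move: Gj; exact/subsetPset/ndG/leq_maxr.
move=> i; have [mF F_oo] := Foo i; have [mG G_oo] := Goo i.
split; first exact: measurable_cyl.
by rewrite cons_product_cyl// lte_mul_pinfty// ge0_fin_numE.
Qed.

HB.instance Definition _ := Measure_isSigmaFinite.Build _ _ _
  (cons_product mu nu) cons_product_sigma_finite.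

End cons_product.

Section power_measure.
Local Open Scope ereal_scope.
Context d (T : measurableType d) (R : realType).

(* The n-fold product of mu with itself; power_measure_box characterizes it.
   For a probability mu this is the law of n i.i.d. samples from mu. *)
Fixpoint power_measure (mu : set T -> \bar R) n : set (n.-tuple T) -> \bar R :=
  match n return set (n.-tuple T) -> \bar R with
  | 0 => \d_([tuple] : 0.-tuple T)
  | n'.+1 => cons_product mu (@power_measure mu n')
  end.
Arguments power_measure mu n A : clear implicits.

Section sigma_finite.
Variables (mu : {sigma_finite_measure set T -> \bar R}) (n : nat).

Let power_measure_packed :
  {m : {sigma_finite_measure set (n.-tuple T) -> \bar R} | power_measure mu n = m}.
Proof.
elim: n => [|m [nu IH]]; first by exists (\d_([tuple] : 0.-tuple T)).
by exists (cons_product mu nu); rewrite /= IH.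
Qed.

Let power_measure0 : power_measure mu n set0 = 0.
Proof. by have [m ->] := power_measure_packed; exact: measure0. Qed.

Let power_measure_ge0 A : 0 <= power_measure mu n A.
Proof. by have [m ->] := power_measure_packed; exact: measure_ge0. Qed.

Let power_measure_sigma_additive : semi_sigma_additive (power_measure mu n).
Proof.
by have [m ->] := power_measure_packed; exact: measure_semi_sigma_additive.
Qed.

HB.instance Definition _ := isMeasure.Build _ _ _ (power_measure mu n)
  power_measure0 power_measure_ge0 power_measure_sigma_additive.

Let power_measure_sigma_finite : sigma_finite setT (power_measure mu n).
Proof. by have [m ->] := power_measure_packed; exact: sigma_finiteT. Qed.

HB.instance Definition _ := Measure_isSigmaFinite.Build _ _ _
  (power_measure mu n) power_measure_sigma_finite.
End sigma_finite.

Lemma power_measure_box (mu : {sigma_finite_measure set T -> \bar R}) n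
    (B : 'I_n -> set T) : (forall i, measurable (B i)) ->
  power_measure mu n [set t | forall i, B i (tnth t i)] = \prod_(i < n) mu (B i).
Proof.
elim: n B => [|n IH] B mB.
  rewrite big_ord0 (_ : [set _ | _] = setT) /=; first exact: diracT.
  by apply/seteqP; split=> // t _ [].
have mbox : measurable [set t : n.-tuple T | forall i, B (lift ord0 i) (tnth t i)].
  rewrite (_ : [set _ | _] = \bigcap_(i in [set: 'I_n])
     ((@tnth n T ^~ i) @^-1` B (lift ord0 i))); last first.
    by apply/seteqP; split=> t /= tB i => [_|]; exact: tB.
  apply: fin_bigcap_measurable => // i _; rewrite -[X in measurable X]setTI.
  exact: measurable_tnth.
rewrite (_ : [set _ | _] = cyl (B ord0)
  [set t : n.-tuple T | forall i, B (lift ord0 i) (tnth t i)]).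
  by rewrite big_ord_recl -IH//; exact: (cons_product_cyl mu (power_measure mu n)).
have tnth_lift (t : n.+1.-tuple T) j :
    tnth t (lift ord0 j) = tnth [tuple of behead t] j.
  by rewrite {1}(tuple_eta t) tnthS.
apply/seteqP; split=> t /=.
  by move=> tB; split=> [|i]; [exact: tB|rewrite -tnth_lift; exact: tB].
by case=> t0 tB i; have [j ->|->//] := unliftP ord0 i; rewrite tnth_lift.
Qed.

Section probability.
Variables (P : probability T R) (n : nat).

Let power_measureT : power_measure P n setT = 1.
Proof.
rewrite (_ : setT = [set t : n.-tuple T | forall i, [set: T] (tnth t i)]).
  rewrite (power_measure_box P (B := fun=> setT))// big1// => i _.
  exact: probability_setT.
exact/seteqP.
Qed.

HB.instance Definition _ := Measure_isProbability.Build _ _ _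
  (power_measure P n) power_measureT.
End probability.

End power_measure.
Arguments power_measure {d T R} mu n A.

Section euclidean.
Context (R : realType) (d : nat).

Definition espace := d.-tuple (measurableTypeR R).

Definition lebesgue_measure_tuple : set espace -> \bar R :=
  power_measure lebesgue_measure d.

Definition eucl_dist (x y : espace) : R :=
  Num.sqrt (\sum_(i < d) (tnth x i - tnth y i) ^+ 2).

(* A finite second moment of eucl_dist x (mean P) under P makes every coordinate
   integrable, so fine then discards nothing. *)
Definition mean (P : probability espace R) : espace :=
  [tuple fine ('E_P[fun x => tnth x i])%E | i < d].

Definition mixture k (w : 'I_k -> R) (Q : 'I_k -> probability espace R)
    (P : probability espace R) : Prop :=
  [/\ forall i, 0 <= w i, \sum_(i < k) w i = 1 &
      forall A, measurable A -> P A = (\sum_(i < k) (w i)%:E * Q i A)%E].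

Definition density_bounded_by (P : probability espace R) (rho : R) : Prop :=
  exists f : espace -> R,
    [/\ measurable_fun setT f, forall x, 0 <= f x <= rho &
        forall A, measurable A ->
          P A = (\int[lebesgue_measure_tuple]_(x in A) (f x)%:E)%E].

Definition diam (s : seq espace) : R :=
  \big[Num.max/0]_(x <- s) \big[Num.max/0]_(y <- s) eucl_dist x y.

(* The points of s are viewed as a finite type (repetitions are ignored). For
   l = 0 and s nonempty no partition qualifies and the value is +oo. *)
Definition diam_parts (l : nat) (s : seq espace) : \bar R :=
  \big[Order.min/+oo%E]_(S : {set {set seq_sub s}} |
      finset.partition S [set: seq_sub s]%SET && (#|S| <= l)%N)
    (\big[Num.max/0]_(A in S) diam [seq val x | x in A])%:E.

Definition two_k_sequence (k : nat) (y : seq espace) : Prop :=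
  forall j, (0 < j < size y)%N ->
    (2%:E * diam_parts k.-1 (take j y) <
     \big[Order.min/+oo]_(x <- take j y) (eucl_dist x (nth x y j))%:E)%E.

Definition is_two_k_sequence_of (k : nat) (X y : seq espace) : Prop :=
  [/\ uniq y, {subset y <= X} & two_k_sequence k y].

(* The bound on m only makes the range finite: a sequence of distinct points
   of X has at most size X terms, see OC_attained and OC_max. *)
Definition OC (k : nat) (X : seq espace) : nat :=
  \max_(m < (size X).+1 |
      `[< exists2 y, size y = m & is_two_k_sequence_of k X y >]) m.

Lemma OC_attained k X : exists2 y, size y = OC k X & is_two_k_sequence_of k X y.
Proof.
pose A := fun m : 'I_(size X).+1 =>
  `[< exists2 y, size y = m & is_two_k_sequence_of k X y >].
have A0 : (0 < #|A|)%N.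
  apply/card_gt0P; exists ord0; apply/asboolP.
  by exists [::] => //; split=> // j; rewrite andbC.
have [m /asboolP[y ym yX] E] := eq_bigmax_cond (@nat_of_ord _) A0.
by exists y => //; rewrite ym -E.
Qed.

Lemma OC_max k X y : is_two_k_sequence_of k X y -> (size y <= OC k X)%N.
Proof.
move=> yX; have ltyX : (size y < (size X).+1)%N.
  by case: yX => uy sub _; rewrite ltnS uniq_leq_size.
apply: (@leq_bigmax_cond _ (fun m : 'I_(size X).+1 =>
  `[< exists2 y, size y = m & is_two_k_sequence_of k X y >])
  (@nat_of_ord _) (Ordinal ltyX)).
by apply/asboolP; exists y.
Qed.

End euclidean.

(* Main.v *)
Require Import Defs.
From mathcomp Require Import all_boot all_order all_algebra.
From mathcomp Require Import all_classical all_reals all_analysis.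
From mathcomp Require Import ring lra zify.
Import Order.TTheory GRing.Theory Num.Theory.
Import numFieldNormedType.Exports.
Local Open Scope classical_set_scope.
Local Open Scope ring_scope.

(* If distinct points of X are at distance >= r, then in a (2,k)-sequence of
   points of X every term of index >= i * k is at distance >= 2^i * r from all
   the previous ones: the k terms of indices in [(i-1) * k, i * k) are pairwise
   2^(i-1) * r apart, and two of them share a part of any partition into k - 1
   parts. Hence OC_k(X) = O(k log(diam X / r)), which is stronger than required.
   With probability >= 1 - 2/n the aspect ratio diam X / r is at most polynomial
   in n: by Markov's inequality all samples are within n * sqrt D of the mean,
   except with probability 1/n, and by the density bound two given samples are
   closer than r = 1 / (2 n^3 (1 + rho)) with probability at most
   rho (2 r)^d <= 1/n^3. *)

(** * Euclidean distance and diameters *)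

Lemma eucl_distC {R : realType} {d} (x y : espace R d) :
  eucl_dist x y = eucl_dist y x.
Proof.
by rewrite /eucl_dist; congr Num.sqrt; apply: eq_bigr => i _; rewrite -sqrrN opprB.
Qed.

Lemma eucl_dist_ge0 {R : realType} {d} (x y : espace R d) : 0 <= eucl_dist x y.
Proof. exact: sqrtr_ge0. Qed.

Lemma eucl_dist_sqr {R : realType} {d} (x y : espace R d) :
  eucl_dist x y ^+ 2 = \sum_(i < d) (tnth x i - tnth y i) ^+ 2.
Proof. by rewrite sqr_sqrtr// sumr_ge0// => i _; exact: sqr_ge0. Qed.

(** Coordinatewise, [2 (a - e)^2 + 2 (b - e)^2 - (a - b)^2 = (a + b - 2 e)^2], which takes the place
    of the triangle inequality. *)
Lemma eucl_dist_center {R : realType} {d} (c x y : espace R d) (r : R) : 0 <= r ->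
  eucl_dist x c <= r -> eucl_dist y c <= r -> eucl_dist x y <= 2 * r.
Proof.
move=> r0 xr yr; rewrite -ler_sqr ?nnegrE ?eucl_dist_ge0 ?mulr_ge0//.
have xr2 : eucl_dist x c ^+ 2 <= r ^+ 2 by rewrite ler_sqr ?nnegrE// eucl_dist_ge0.
have yr2 : eucl_dist y c ^+ 2 <= r ^+ 2 by rewrite ler_sqr ?nnegrE// eucl_dist_ge0.
apply: (@le_trans _ _ (2 * eucl_dist x c ^+ 2 + 2 * eucl_dist y c ^+ 2)); last lra.
rewrite !eucl_dist_sqr !mulr_sumr -big_split/=; apply: ler_sum => i _.
rewrite -subr_ge0; set a := tnth x i; set b := tnth y i; set e := tnth c i.
rewrite (_ : _ - _ = (a + b - 2 * e) ^+ 2) ?sqr_ge0//; ring.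
Qed.

Lemma diam_ge {R : realType} {d} (s : seq (espace R d)) x y :
  x \in s -> y \in s -> eucl_dist x y <= diam s.
Proof.
move=> xs ys; apply: bigmax_sup_seq xs isT _.
exact: bigmax_sup_seq ys isT (lexx _).
Qed.

(** * Growth of (2,k)-sequences and the deterministic bound on [OC] *)

(** Pigeonhole: [t] has more points than a partition has parts, so two distinct points of [t] share
    a part, whose diameter is then at least [a]. *)
Lemma diam_parts_ge {R : realType} {d} l (s t : seq (espace R d)) (a : R) :
  uniq t -> {subset t <= s} -> (l < size t)%N ->
  {in t &, forall x y, x != y -> a <= eucl_dist x y} ->
  (a%:E <= diam_parts l s)%E.
Proof.
move=> ut ts lt tdist; apply/bigmin_geP; split; first exact: leey.
move=> S /andP[/and3P[/eqP covS trivS _] Sl]; rewrite lee_fin.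
pose A := [set x : seq_sub s | val x \in t]%SET.
have cardA : #|A| = size t.
  rewrite cardE -(size_map val); apply/perm_size/uniq_perm => //.
    by rewrite map_inj_uniq ?enum_uniq//; exact: val_inj.
  move=> x; apply/mapP/idP => [[y]|xt]; first by rewrite mem_enum inE => yt ->.
  by exists (SeqSub (ts _ xt)); rewrite // mem_enum inE.
have covT x : x \in finset.cover S by rewrite covS inE.
have : ~~ dinjectiveb (finset.pblock S) A.
  apply/negP => /dinjectiveP/card_in_imset cardpA.
  suff : (#|finset.pblock S @: A| <= #|S|)%N.
    by rewrite cardpA cardA leqNgt (leq_ltn_trans Sl lt).
  apply/subset_leq_card/fintype.subsetP => _ /imsetP[x _ ->]; exact: finset.pblock_mem.
move=> /dinjectivePn[x xA [y]]; rewrite !inE in xA *; case/andP => yx yt xy.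
apply: (@le_trans _ _ (diam [seq val z | z in finset.pblock S x])).
  apply: le_trans (diam_ge _ (val x) (val y) _ _).
  - by apply: tdist => //; rewrite (inj_eq val_inj) eq_sym.
  - by apply: map_f; rewrite mem_enum finset.mem_pblock.
  - by apply: map_f; rewrite mem_enum xy finset.mem_pblock.
exact: (le_bigmax_cond _ _ (finset.pblock_mem (covT x))).
Qed.

Lemma two_k_sequence_dist {R : realType} {d} k (y : seq (espace R d)) (r : R) i j :
  (0 < k)%N -> uniq y -> {in y &, forall u v, u != v -> r <= eucl_dist u v} ->
  two_k_sequence k y -> (i * k <= j < size y)%N ->
  {in take j y, forall x, 2 ^+ i * r <= eucl_dist x (nth x y j)}.
Proof.
move=> k0 uy ydist ky; elim: i j => [|i IH] j /andP[ij jy] x xj.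
  rewrite mul1r; apply: ydist; rewrite ?(mem_take xj) ?mem_nth//.
  (* The term of index [j] heads [drop j y], so its presence in [take j y] would contradict
     [uniq y]. *)
  apply: contraTneq xj => ->; rewrite -(cat_take_drop j y) in uy.
  have := mem_head (nth x y j) (drop j.+1 y).
  rewrite -drop_nth// => yj; apply: contraTN uy => xj.
  rewrite cat_uniq !negb_and negbK; apply/orP; right; apply/orP; left.
  by apply/hasP; exists (nth x y j).
have j0 : (0 < j)%N by rewrite (leq_trans _ ij)// muln_gt0.
(* Since [(i + 1) k <= j], this window of [k] terms lies inside the prefix [take j y]. *)
pose t := take k (drop (i * k) y).
have szt : size t = k.
  rewrite size_takel// size_drop; rewrite mulSn in ij; lia.
have tnthE x0 a : (a < k)%N -> nth x0 t a = nth x0 y (i * k + a).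
  by move=> ak; rewrite nth_take// nth_drop.
have tdist : {in t &, forall u v, u != v -> 2 ^+ i * r <= eucl_dist u v}.
  have H a b : (a < b < k)%N -> 2 ^+ i * r <= eucl_dist (nth x t a) (nth x t b).
    move=> /andP[ab bk]; rewrite !tnthE ?(ltn_trans ab)//.
    set b' := (i * k + b)%N.
    have b'y : (b' < size y)%N by rewrite mulSn in ij; rewrite /b'; lia.
    (* The induction hypothesis takes the earlier point itself as the default of [nth]; the index is
       in range, so the default can be exchanged. *)
    rewrite (set_nth_default (nth x y (i * k + a)) x b'y).
    apply: IH; first by rewrite b'y leq_addr.
    rewrite -(@nth_take b') /b' ?ltn_add2l// mem_nth// size_takel ?ltn_add2l// ltnW//.
  move=> u v ut vt.
  have /(nthP x)[a] := ut; have /(nthP x)[b] := vt; rewrite szt => bk <- ak <-.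
  case: (ltngtP a b) => [ab|ba|->]; last by rewrite eqxx.
  - by move=> _; apply: H; rewrite ab.
  - by move=> _; rewrite eucl_distC; apply: H; rewrite ba.
have diamt : ((2 ^+ i * r)%:E <= diam_parts k.-1 (take j y))%E.
  apply: (@diam_parts_ge _ _ _ _ t) => //.
  - by rewrite take_uniq// drop_uniq.
  - move=> u ut; have /(nthP x)[a] := ut; rewrite szt => ak <-.
    have aj : (i * k + a < j)%N by rewrite mulSn in ij; lia.
    by rewrite tnthE// -(@nth_take j)// mem_nth// size_takel// ltnW.
  - by rewrite szt prednK.
have := ky j; rewrite j0 jy => /(_ isT) /lt_le_trans lt_.
have {lt_} := lt_ _ (bigmin_inf_seq _ _ _ _ _ xj isT (lexx _)).
rewrite -lee_fin exprS -mulrA EFinM => /ltW; apply: le_trans.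
by rewrite lee_pmul2l.
Qed.

(** A term of index [i * k] would be at distance at least [2 ^+ i * r], hence more than [D], from
    the first term. *)
Lemma two_k_sequence_size {R : realType} {d} k (X y : seq (espace R d)) (r D : R) i :
  (0 < k)%N -> (0 < i)%N -> is_two_k_sequence_of k X y ->
  {in X &, forall u v, u != v -> r <= eucl_dist u v} ->
  {in X &, forall u v, eucl_dist u v <= D} ->
  D < 2 ^+ i * r -> (size y <= i * k)%N.
Proof.
move=> k0 i0 [uy yX ky] Xr XD Dr; rewrite leqNgt; apply/negP => ltiy.
have y0 : (0 < size y)%N by exact: leq_ltn_trans ltiy.
case: y => // x y in uy yX ky ltiy y0 *.
have xj : x \in take (i * k) (x :: y).
  by rewrite -[(i * k)%N]prednK ?muln_gt0 ?i0// mem_head.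
have := XD x (nth x (x :: y) (i * k)); rewrite !yX ?mem_head ?mem_nth// => /(_ isT isT).
apply/negP; rewrite -ltNge (lt_le_trans Dr)//.
apply: (@two_k_sequence_dist _ _ k) => //; last by rewrite leqnn.
by move=> u v uy' vy'; apply: Xr; exact: yX.
Qed.

Lemma OC_le {R : realType} {d} k (X : seq (espace R d)) (r D : R) i :
  (0 < k)%N -> (0 < i)%N ->
  {in X &, forall u v, u != v -> r <= eucl_dist u v} ->
  {in X &, forall u v, eucl_dist u v <= D} ->
  D < 2 ^+ i * r -> (OC k X <= i * k)%N.
Proof.
move=> k0 i0 Xr XD Dr; have [y <- yX] := OC_attained k X.
exact: two_k_sequence_size yX Xr XD Dr.
Qed.

(** * Product measures of one-sample and two-sample events *)

(* Monotonicity holds for every nonnegative integrand and hence, below, for every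
   set: the measurability of the event bounding OC is never needed. *)
Lemma ge0_le_integral_all {dT} {T : measurableType dT} {R : realType}
    (mu : {measure set T -> \bar R}) (f g : T -> \bar R) :
  (forall x, 0 <= f x)%E -> (forall x, f x <= g x)%E ->
  (\int[mu]_x f x <= \int[mu]_x g x)%E.
Proof.
move=> f0 fg; have g0 x : (0 <= g x)%E by exact: le_trans (fg x).
rewrite !ge0_integralTE//; apply: le_ereal_sup => _ [h hf <-].
by exists h => //= x; exact: le_trans (fg x).
Qed.

(** The product measure is defined as the integral of the measures of the sections, so this is an
    unfolding. *)
Lemma power_measureS {dT} {T : measurableType dT} {R : realType}
    (mu : set T -> \bar R) n (A : set (n.+1.-tuple T)) :
  power_measure mu n.+1 A =
  (\int[mu]_x power_measure mu n [set t : n.-tuple T | A (tcons (x, t))])%E.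
Proof.
congr (integral _ _ _); apply/funext => x /=; congr (power_measure mu n _).
by apply/seteqP; split=> t; rewrite /xsection/= inE.
Qed.

Lemma power_measure_subset {dT} {T : measurableType dT} {R : realType}
    (mu : {sigma_finite_measure set T -> \bar R}) n (A B : set (n.-tuple T)) :
  A `<=` B -> (power_measure mu n A <= power_measure mu n B)%E.
Proof.
elim: n A B => [|n IH] A B AB.
  rewrite /= !diracE lee_fin ler_nat.
  by case: (boolP (_ \in A)) => //; rewrite inE => /AB/mem_set ->.
rewrite !power_measureS; apply: ge0_le_integral_all => x.
  exact: (measure_ge0 (power_measure mu n)).
by apply: IH => t; exact: AB.
Qed.

(** The event is a box with [A] in position [i] and the whole space, of mass 1, elsewhere. *)
Lemma power_measure_tnth {dT} {T : measurableType dT} {R : realType}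
    (P : probability T R) n (i : 'I_n) (A : set T) : measurable A ->
  power_measure P n [set t | A (tnth t i)] = P A.
Proof.
move=> mA; pose B j := if j == i then A else setT.
rewrite (_ : [set _ | _] = [set t | forall j, B j (tnth t j)]); last first.
  apply/seteqP; split=> t /= H; last by have := H i; rewrite /B eqxx.
  by move=> j; rewrite /B; case: eqP => // ->.
rewrite power_measure_box => [|j]; last by rewrite /B; case: ifP.
rewrite (bigD1 i)//= big1 ?mule1 /B ?eqxx// => j /negbTE ->.
exact: probability_setT.
Qed.

(** Induction on [n], integrating over the first sample. If [i] is not first, neither is [j], and
    the induction hypothesis applies to the remaining samples. If [i] is first, fixing its value [x]
    forces sample [j] into a section of [E]. *)
Lemma power_measure_pair {dT} {T : measurableType dT} {R : realType}
    (P : probability T R) n (i j : 'I_n) (E : set (T * T)) (p : \bar R) :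
  (forall x, P (xsection E x) <= p)%E -> measurable E -> (i < j)%N ->
  (power_measure P n [set t | E (tnth t i, tnth t j)] <= p)%E.
Proof.
move=> Ep mE; have p0 : (0 <= p)%E by exact: le_trans (Ep point).
have intp : (\int[P]_x (cst p x) = p)%E.
  rewrite integral_cst// -[RHS]mule1; congr (_ * _)%E; exact: probability_setT.
elim: n i j => [[]//|n IH] i j.
rewrite power_measureS -[leRHS]intp.
have [i'|] := unliftP ord0 i; have [j'|] := unliftP ord0 j; move=> -> -> // ij.
- apply: ge0_le_integral_all => x.
    exact: (measure_ge0 (power_measure P n)).
  apply: le_trans (IH i' j' ij); apply: power_measure_subset => t /=.
  by rewrite !tnthS.
- apply: ge0_le_integral_all => x.
    exact: (measure_ge0 (power_measure P n)).
  apply: le_trans (Ep x).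
  rewrite -(power_measure_tnth P n j' _ (measurable_xsection x mE)).
  apply: power_measure_subset => t /=.
  by rewrite tnthS tnth0 /xsection/= inE.
Qed.

Lemma measure_bigsetU_le {dT} {T : measurableType dT} {R : realType}
    (mu : {measure set T -> \bar R}) (I : Type) (s : seq I) (Q : pred I)
    (A : I -> set T) : (forall i, Q i -> measurable (A i)) ->
  (mu (\big[setU/set0]_(i <- s | Q i) A i) <= \sum_(i <- s | Q i) mu (A i))%E.
Proof.
move=> mA; elim: s => [|i s IH]; first by rewrite !big_nil measure0.
rewrite !big_cons; case: ifPn => // Qi.
apply: le_trans (measureU2 _ _ _) (leeD2l _ IH); first exact: mA.
exact: bigsetU_measurable.
Qed.

(** * Measurability, small-ball and tail estimates for one sample *)

Lemma measurable_set_ltr {R : realType} {dT} {T : measurableType dT}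
    (f g : T -> R) : measurable_fun setT f -> measurable_fun setT g ->
  measurable [set t | f t < g t].
Proof.
move=> mf mg; rewrite -[X in measurable X]setTI.
exact: (@measurable_realfun.measurable_fun_ltr _ _ _ setT f g _ _ _ [set true]).
Qed.

Lemma measurable_set_ler {R : realType} {dT} {T : measurableType dT}
    (f g : T -> R) : measurable_fun setT f -> measurable_fun setT g ->
  measurable [set t | f t <= g t].
Proof.
move=> mf mg; rewrite -[X in measurable X]setTI.
exact: (@measurable_realfun.measurable_fun_ler _ _ _ setT f g _ _ _ [set true]).
Qed.

(** The square is a polynomial in the coordinates; the events below are therefore phrased with
    squared distances. *)
Lemma measurable_eucl_dist_sqr {R : realType} {d dT} {T : measurableType dT}
    (f g : T -> espace R d) : measurable_fun setT f -> measurable_fun setT g ->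
  measurable_fun setT (fun t => eucl_dist (f t) (g t) ^+ 2 : R).
Proof.
move=> mf mg; under eq_fun do rewrite eucl_dist_sqr.
apply: measurable_sum => i; apply: measurable_realfun.measurable_funX.
apply: measurable_realfun.measurable_funB.
- exact: (measurableT_comp (measurable_tnth i) mf).
- exact: (measurableT_comp (measurable_tnth i) mg).
Qed.

(** The ball of radius [r] about [x] lies in a cube of side [2 * r], over which the density is
    integrated. *)
Lemma density_close_le {R : realType} {d} (P : probability (espace R d) R)
    (rho r : R) (x : espace R d) : 0 <= rho -> 0 <= r -> density_bounded_by P rho ->
  (P [set y | (eucl_dist x y ^+ 2 < r ^+ 2)%R] <= (rho * (2 * r) ^+ d)%:E)%E.
Proof.
move=> rho0 r0 [f [mf f_rho Pf]].
set B := [set y | _].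
pose box := [set y : espace R d | forall i,
  [set` `[tnth x i - r, tnth x i + r]%R] (tnth y i)].
have mB : measurable B.
  by apply: measurable_set_ltr => //; exact: measurable_eucl_dist_sqr.
have Bbox : B `<=` box.
  move=> y; rewrite /B/= => xyr i; rewrite /= in_itv/=.
  rewrite eucl_dist_sqr in xyr.
  have : (tnth x i - tnth y i) ^+ 2 <= r ^+ 2.
    apply: le_trans (ltW xyr); rewrite (bigD1 i)//= lerDl sumr_ge0// => j _.
    exact: sqr_ge0.
  rewrite -[leLHS]real_normK ?num_real// ler_sqr ?nnegrE// ler_norml.
  by move=> /andP[? ?]; apply/andP; split; lra.
have lebbox : lebesgue_measure_tuple box = ((2 * r) ^+ d)%:E.
  rewrite /lebesgue_measure_tuple (power_measure_box lebesgue_measure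
    (B := fun i => [set` `[tnth x i - r, tnth x i + r]%R]))//.
  rewrite (eq_bigr (fun=> (2 * r)%:E)) => [|i _].
    by rewrite prodEFin prodr_const card_ord.
  rewrite [LHS]lebesgue_measure_itv/= lte_fin -EFinD.
  (* An empty or degenerate interval forces [r = 0], and then its measure 0 is still [2 * r]. *)
  case: ltP => [_|]; first by congr EFin; lra.
  by move=> ?; congr EFin; lra.
pose leb : {measure set (espace R d) -> \bar R} := power_measure lebesgue_measure d.
have fB : (\int[leb]_(y in B) (f y)%:E <= \int[leb]_(y in B) rho%:E)%E.
  apply: ge0_le_integral => //.
  - by move=> y _; rewrite lee_fin; case/andP: (f_rho y).
  - exact/measurable_realfun.measurable_EFinP/measurable_funTS.
  - by move=> y _; rewrite lee_fin; case/andP: (f_rho y).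
rewrite Pf//; apply: le_trans fB _.
rewrite integral_cst// EFinM lee_wpmul2l ?lee_fin//.
by rewrite -lebbox; exact: power_measure_subset.
Qed.

(** Markov's inequality gives the same bound for every component, and a convex combination preserves
    it. *)
Lemma mixture_far_le {R : realType} {d k} (w : 'I_k -> R)
    (Q : 'I_k -> probability (espace R d) R) (P : probability (espace R d) R)
    (c : espace R d) (D a : R) : 0 < a -> mixture w Q P ->
  (forall i, ('E_(Q i)[fun x => (eucl_dist x c ^+ 2)%R] <= D%:E)%E) ->
  (P [set x | (a <= eucl_dist x c ^+ 2)%R] <= (D / a)%:E)%E.
Proof.
move=> a0 [w0 w1 PQ] QD.
have mf : measurable_fun setT (fun x : espace R d => eucl_dist x c ^+ 2 : R).
  exact: measurable_eucl_dist_sqr.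
set A := [set x | _].
have mA : measurable A.
  exact: (@measurable_set_ler _ _ _ (fun=> a)).
have QA i : (Q i A <= (D / a)%:E)%E.
  rewrite EFinM lee_pdivlMr// muleC; apply: le_trans (QD i).
  (* This is Markov's inequality, with the identity as the nondecreasing function. *)
  have := @le_integral_comp_abse _ _ _ (Q i) setT measurableT
    (fun x => (eucl_dist x c ^+ 2)%:E) a id.
  have -> : (fun x => `|(eucl_dist x c ^+ 2)%:E|%E) = (fun x => (eucl_dist x c ^+ 2)%:E).
    by apply/funext => x; rewrite gee0_abs ?lee_fin ?sqr_ge0.
  rewrite setTI unlock => markov.
  rewrite (_ : A = [set x | (a%:E <= `|(eucl_dist x c ^+ 2)%:E|)%E]).
    by apply: markov => //; exact/measurable_realfun.measurable_EFinP.
  by apply/seteqP; split=> x; rewrite /A/= lee_fin ger0_norm ?sqr_ge0.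
rewrite PQ//; apply: (@le_trans _ _ (\sum_(i < k) (w i * (D / a))%:E)%E).
  by apply: lee_sum => i _; rewrite EFinM lee_wpmul2l ?lee_fin.
by rewrite sumEFin -mulr_suml w1 mul1r.
Qed.

(** * Union bound over the samples, and the conclusion *)

(** The complement is covered by [n] one-sample events of mass at most [a] and at most [n^2] pair
    events of mass at most [p]. *)
Lemma power_measure_avoid {dT} {T : measurableType dT} {R : realType}
    (P : probability T R) n (S : set T) (E : set (T * T)) (a p : R) :
  measurable S -> measurable E -> 0 <= p -> (P S <= a%:E)%E ->
  (forall x, P (xsection E x) <= p%:E)%E ->
  ((1 - (n%:R * a + n%:R ^+ 2 * p))%:E <= power_measure P n
     [set t | (forall i, ~ S (tnth t i)) /\
              forall i j : 'I_n, (i < j)%N -> ~ E (tnth t i, tnth t j)])%E.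
Proof.
move=> mS mE p0 Sa Ep.
pose F i := [set t : n.-tuple T | S (tnth t i)].
pose G (ij : 'I_n * 'I_n) := [set t : n.-tuple T | E (tnth t ij.1, tnth t ij.2)].
have mF i : measurable (F i).
  by rewrite -[X in measurable X]setTI; exact: measurable_tnth.
have mG ij : measurable (G ij).
  rewrite -[X in measurable X]setTI.
  by apply: measurable_fun_pair => //; exact: measurable_tnth.
pose bad1 := \big[setU/set0]_(i : 'I_n) F i.
pose bad2 := \big[setU/set0]_(ij : 'I_n * 'I_n | (ij.1 < ij.2)%N) G ij.
have mbad1 : measurable bad1 by exact: bigsetU_measurable.
have mbad2 : measurable bad2 by exact: bigsetU_measurable.
have bad1_le : (power_measure P n bad1 <= (n%:R * a)%:E)%E.
  apply: le_trans (measure_bigsetU_le (power_measure P n) _ _ _ _ _) _ => //.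
  apply: (@le_trans _ _ (\sum_(i < n) a%:E)%E).
    apply: lee_sum => i _; apply: le_trans Sa.
    by rewrite -(power_measure_tnth P n i S mS).
  by rewrite sumEFin sumr_const card_ord mulr_natl.
have bad2_le : (power_measure P n bad2 <= (n%:R ^+ 2 * p)%:E)%E.
  apply: le_trans (measure_bigsetU_le (power_measure P n) _ _ _ _ _) _ => //.
  apply: (@le_trans _ _ (\sum_(ij : 'I_n * 'I_n | (ij.1 < ij.2)%N) p%:E)%E).
    by apply: lee_sum => ij ltij; exact: power_measure_pair.
  rewrite sumEFin sumr_const lee_fin -natrX mulr_natl; apply: ler_wpMn2l => //.
  by rewrite (leq_trans (max_card _))// card_prod card_ord mulnn.
apply: (@le_trans _ _ (power_measure P n (~` (bad1 `|` bad2)))).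
  rewrite (probability_setC (power_measure P n)); last exact: measurableU.
  rewrite EFinB leeB// EFinD; apply: le_trans (measureU2 _ _ _) _ => //.
  exact: leeD.
apply: power_measure_subset => t tbad; split=> [i Si|i j ij Eij]; apply: tbad.
- by left; rewrite /bad1 (bigD1 i)//=; left.
- by right; rewrite /bad2 (bigD1 (i, j))//=; left.
Qed.

Theorem theorem8 (R : realType) (d : nat) (D rho : R)
    (d_gt0 : (0 < d)%N) (D_gt0 : 0 < D) (rho_gt0 : 0 < rho) :
  exists (C : R) (n0 : nat),
    forall (k : nat) (w : 'I_k -> R) (Q : 'I_k -> probability (espace R d) R)
      (P : probability (espace R d) R),
    mixture w Q P ->
    (forall i : 'I_k,
      ('E_(Q i)[fun x => (eucl_dist x (mean P) ^+ 2)%R] <= D%:E)%E) ->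
    density_bounded_by P rho ->
    forall n : nat, (n0 <= n)%N ->
    ((1 - 2 / n%:R)%R%:E <=
     power_measure P n
       [set X : n.-tuple (espace R d) |
         ((OC k X)%:R <= C * k%:R ^+ 2 * ln n%:R :> R)%R])%E.
Proof.
set s := Num.sqrt D.
have s0 : 0 < s by rewrite sqrtr_gt0.
have sD : s ^+ 2 = D by rewrite sqr_sqrtr// ltW.
(* The threshold gives [n >= 2] and [4 * s * (1 + rho) < n]. The aspect ratio is then below [n^5],
   whence a factor 5; rounding the binary logarithm of [n] doubles it, and [ln 2] changes the
   base. *)
exists (10 / ln 2), (maxn 2 (Num.bound (4 * s * (1 + rho)))).
move=> k w Q P mixP QD densP n; rewrite geq_max => /andP[n2 nK].
have k0 : (0 < k)%N.
  (* An empty family of weights would sum to 0 instead of 1. *)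
  case: k w Q mixP {QD} => // w Q [_ + _].
  by rewrite big_ord0 => /eqP; rewrite eq_sym oner_eq0.
have n0 : 0 < n%:R :> R by rewrite ltr0n (leq_trans _ n2).
have n1 : 1 <= n%:R :> R by rewrite ler1n (leq_trans _ n2).
have {}nK : 4 * s * (1 + rho) < n%:R.
  apply: lt_le_trans (archi_boundP _) _; last by rewrite ler_nat.
  by rewrite !mulr_ge0 ?ltW//; lra.
set N : R := n%:R in n0 n1 nK *.
pose r := (2 * N ^+ 3 * (1 + rho))^-1.
have rinv0 : 0 < 2 * N ^+ 3 * (1 + rho) by rewrite !mulr_gt0 ?exprn_gt0//; lra.
have r0 : 0 < r by rewrite invr_gt0.
pose S := [set x | (N ^+ 2 * D <= eucl_dist x (mean P) ^+ 2)%R].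
pose E := [set xy : espace R d * espace R d | (eucl_dist xy.1 xy.2 ^+ 2 < r ^+ 2)%R].
have mS : measurable S.
  apply: (@measurable_set_ler _ _ _ (fun=> N ^+ 2 * D)) => //.
  exact: measurable_eucl_dist_sqr.
have mE : measurable E.
  by apply: measurable_set_ltr => //; exact: measurable_eucl_dist_sqr.
have PS : (P S <= (N ^- 2)%:E)%E.
  have -> : N ^- 2 = D / (N ^+ 2 * D).
    by field; rewrite !gt_eqF.
  by apply: mixture_far_le mixP QD; rewrite mulr_gt0 ?exprn_gt0.
have PE x : (P (xsection E x) <= (N ^- 3)%:E)%E.
  have -> : xsection E x = [set y | (eucl_dist x y ^+ 2 < r ^+ 2)%R].
    by apply/seteqP; split=> y; rewrite /xsection/= inE.
  apply: le_trans (density_close_le P rho r x (ltW rho_gt0) (ltW r0) densP) _.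
  rewrite lee_fin.
  have r2 : 2 * r = (N ^+ 3 * (1 + rho))^-1.
    by rewrite /r; field; rewrite !gt_eqF//; lra.
  have r21 : 2 * r <= 1.
    rewrite r2 invf_le1 ?mulr_gt0 ?exprn_gt0//; last by lra.
    by rewrite -[leLHS]mulr1 ler_pM// ?exprn_ege1//; lra.
  (* As [2 * r <= 1] and [d] is positive, the power is at most its base, so one choice of [r] serves
     every dimension. *)
  apply: (@le_trans _ _ (rho * (2 * r))).
    apply: ler_wpM2l; first exact: ltW.
    by rewrite -(prednK d_gt0) exprS ler_piMr ?exprn_ile1//; lra.
  rewrite r2 invfM mulrCA; apply: ler_piMr; first by rewrite invr_ge0 exprn_ge0// ltW.
  by rewrite ler_pdivrMr; lra.
have N3 : 0 <= N ^- 3 by rewrite invr_ge0 exprn_ge0// ltW.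
have := power_measure_avoid P n S E _ _ mS mE N3 PS PE.
(* The [n] samples at [N ^- 2] each and the [n^2] pairs at [N ^- 3] each contribute [1 / N]
   apiece. *)
rewrite (_ : n%:R * _ + _ = 2 / N); last by rewrite -/N; field; rewrite gt_eqF.
move=> /le_trans; apply; apply: power_measure_subset => X [XS XE] /=.
pose t := trunc_log 2 n.
have t0 : (0 < t)%N by rewrite trunc_log_gt0.
have tn : (2 ^ t <= n)%N by apply: trunc_logP => //; exact: ltnW n2.
have nt : (n < 2 ^ t.+1)%N by exact: trunc_log_ltn.
have OCt : (OC k X <= 5 * t.+1 * k)%N.
  apply: (@OC_le _ _ _ _ r (2 * (N * s))) => //.
  - move=> u v /tnthP[i ->] /tnthP[j ->].
    have far (i' j' : 'I_n) : (i' < j')%N -> r <= eucl_dist (tnth X i') (tnth X j').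
      move=> /XE/negP; rewrite -leNgt ler_sqr ?nnegrE ?eucl_dist_ge0//; exact: ltW.
    case: (ltngtP i j) => [ij _|ji _|/val_inj->]; last by rewrite eqxx.
      exact: far.
    by rewrite eucl_distC; exact: far.
  - have near i : eucl_dist (tnth X i) (mean P) <= N * s.
      have /negP := XS i; rewrite -ltNge -sD -exprMn => /ltW.
      by rewrite ler_sqr ?nnegrE ?eucl_dist_ge0// mulr_ge0// ltW.
    move=> u v /tnthP[i ->] /tnthP[j ->].
    by apply: (eucl_dist_center (mean P)) => //; rewrite mulr_ge0// ltW.
  (* The chain is [2 N s / r = N^4 (4 s (1 + rho)) < N^5 <= 2^(5 (t + 1))], the last step from
     [n < 2^(t + 1)]. *)
  - have N5 : N ^+ 5 <= 2 ^+ (5 * t.+1).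
      rewrite mulnC exprM ler_pXn2r ?nnegrE ?exprn_ge0 ?(ltW n0)//.
      by rewrite /N -natrX ler_nat ltnW.
    apply: (@lt_le_trans _ _ (N ^+ 5 * r)); last by rewrite ler_pM2r.
    rewrite /r ltr_pdivlMr//.
    have -> : 2 * (N * s) * (2 * N ^+ 3 * (1 + rho)) =
      N ^+ 4 * (4 * s * (1 + rho)) by ring.
    by rewrite (exprSr N 4) ltr_pM2l ?exprn_gt0.
apply: (@le_trans _ _ (5 * t.+1 * k)%:R); first by rewrite ler_nat.
have ln20 : 0 < ln 2 :> R by rewrite ln_gt0// ltr1n.
have tln : t%:R * ln 2 <= ln N.
  by rewrite mulr_natl -lnXn// ler_ln ?posrE ?exprn_gt0// -natrX ler_nat.
apply: (@le_trans _ _ (10 * t%:R * k%:R ^+ 2)).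
  (* Here [t + 1 <= 2 t] uses [t >= 1], and the linear factor [k] is weakened to [k^2]. *)
  rewrite -natrX -!natrM ler_nat; apply: leq_mul; last by rewrite leq_pmulr.
  by move: t0; clear; lia.
rewrite [leRHS](_ : _ = 10 * (ln N / ln 2) * k%:R ^+ 2); last by ring.
by rewrite ler_wpM2r ?exprn_ge0// ler_wpM2l// ler_pdivlMr.
Qed.
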